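(* Let $e^{-f_t}$ and $e^{-g_t}$ be log-concave probability densities on $\mathbb R^{n_x}$ and $\mathbb R^{n_z}$ respectively, for $t=0,\dots,T$, let $F_0,\dots,F_{T-1}$ be real $n_x\times n_x$ matrices, $H_0,\dots,H_T$ real $n_z\times n_x$ matrices, and $z_0,\dots,z_T\in\mathbb R^{n_z}$. Then the dual problem associated with the estimation problem $$\min_{x_0,\dots,x_T}\ \sum_{t=0}^T f_t(w_t)+\sum_{t=0}^T g_t(z_t-H_tx_t)\quad\text{s.t. } x_{t+1}=F_tx_t+w_{t+1}\ (t=0,\dots,T-1),\ \ x_0=w_0$$ is the optimal control problem $$\sup_{u_0,\dots,u_T}\ \sum_{t=0}^T\big(z_t'u_t-f_t^*(y_t)-g_t^*(u_t)\big)\quad\text{s.t. } y_t=F_t'y_{t+1}+H_t'u_t\ (t=0,\dots,T-1),\ \ y_T=H_T'u_T .$$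
   Context: Prime denotes transpose; $h^*(y)=\sup_x\{\langle x,y\rangle-h(x)\}$ is the convex conjugate. A log-concave density has the form $e^{-f}$ with $f$ convex with values in $(-\infty,\infty]$ and $e^{-\infty}=0$; by convention each $f_t$ and $g_t$ is taken to be its lower semicontinuous version (this changes the density only on a null set). In the estimation problem, $w_0,\dots,w_T\in\mathbb R^{n_x}$ are determined by $x_0,\dots,x_T\in\mathbb R^{n_x}$ through the constraints; in the control problem, $y_0,\dots,y_T\in\mathbb R^{n_x}$ are determined by the controls $u_0,\dots,u_T\in\mathbb R^{n_z}$ through the constraints. Duality: a minimization problem $\min_{p\in C}h(p)$ and a maximization problem $\max_{q\in D}k(q)$ are dual to each other via a convex-concave function $L:C\times D\to[-\infty,\infty]$ if $h(p)=\sup_{q\in D}L(p;q)$ for all $p\in C$ and $k(q)=\inf_{p\in C}L(p;q)$ for all $q\in D$. Constraints are incorporated by giving the objective the value $+\infty$ (minimization) or $-\infty$ (maximization) at points violating them. Here $p=(w,x)\in C=\mathbb R^{(T+1)n_x}\times\mathbb R^{(T+1)n_x}$, $q=(u,y)\in D=\mathbb R^{(T+1)n_z}\times\mathbb R^{(T+1)n_x}$, and $$L(w,x;u,y)=\sum_{t=0}^T\big(f_t(w_t)+z_t'u_t-g_t^*(u_t)-u_t'H_tx_t\big)+y_0'(x_0-w_0)+\sum_{t=0}^{T-1}y_{t+1}'(x_{t+1}-F_tx_t-w_{t+1}),$$ with the indeterminate expression $\infty-\infty$ assigned the value $+\infty$. *)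

(* Defs.v *)
From HB Require Import structures.
From mathcomp Require Import all_boot all_order all_algebra.
From mathcomp Require Import all_classical all_reals all_analysis.
From mathcomp Require Import measurable_realfun.

Set Implicit Arguments.
Unset Strict Implicit.
Unset Printing Implicit Defensive.

Import Order.TTheory GRing.Theory Num.Theory.
Import numFieldNormedType.Exports.

Local Open Scope classical_set_scope.
Local Open Scope ring_scope.

Definition dotv (R : realType) (n : nat) (x y : 'cV[R]_n) : R :=
  (x^T *m y) 0 0.

Section ConvexAnalysis.
Context {R : realType}.

(* Convexity of an extended-real-valued function is convexity of its epigraph,
   which is meaningful for functions taking both values -oo and +oo. *)
Definition epigraph (E : lmodType R) (C : set E) (h : E -> \bar R)
    : set (E * R^o)%type :=
  [set p | C p.1 /\ (h p.1 <= (p.2 : R)%:E)%E].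

Definition econvex (E : lmodType R) (C : set E) (h : E -> \bar R) : Prop :=
  convex_set (epigraph C h).

Definition econcave (E : lmodType R) (C : set E) (h : E -> \bar R) : Prop :=
  econvex C (fun x => - h x)%E.

Definition convex_conjugate (n : nat) (h : 'cV[R]_n -> \bar R) (y : 'cV[R]_n)
    : \bar R :=
  ereal_sup [set ((dotv x y)%:E - h x)%E | x in setT].

Definition convex_concave (P Q : lmodType R) (C : set P) (D : set Q)
    (L : P -> Q -> \bar R) : Prop :=
  (forall q, D q -> econvex C (fun p => L p q)) /\
  (forall p, C p -> econcave D (L p)).

(* The problems of minimizing h over C and of maximizing k over D are dual to
   each other via L. *)
Definition dual_problems (P Q : lmodType R) (C : set P) (D : set Q)
    (h : P -> \bar R) (k : Q -> \bar R) (L : P -> Q -> \bar R) : Prop :=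
  [/\ convex_concave C D L,
      forall p, C p -> h p = ereal_sup [set L p q | q in D] &
      forall q, D q -> k q = ereal_inf [set L p q | p in C]].

End ConvexAnalysis.

Section Density.
Context {R : realType}.

(* Lebesgue measure on R^n, as the n-fold product of the one-dimensional one;
   the sigma-algebra on n-tuples is the product of the Borel ones. *)
Fixpoint lebesgue_tuple (n : nat)
    : set (n.-tuple (measurableTypeR R)) -> \bar R :=
  match n return set (n.-tuple (measurableTypeR R)) -> \bar R with
  | 0%N => \d_[tuple]
  | m.+1 => pushforward (lebesgue_measure \x lebesgue_tuple (n:=m))%E
              (fun p : measurableTypeR R * m.-tuple (measurableTypeR R) =>
                 cons_tuple p.1 p.2 : m.+1.-tuple (measurableTypeR R))
  end.

Definition col_of_tuple (n : nat) (s : n.-tuple (measurableTypeR R))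
    : 'cV[R]_n :=
  \col_i (tnth s i : R).

Definition probability_density (n : nat) (p : 'cV[R]_n -> \bar R) : Prop :=
  [/\ forall x, (0 <= p x)%E,
      measurable_fun setT (p \o @col_of_tuple n) &
      (\int[@lebesgue_tuple n]_(s in setT) p (col_of_tuple s) = 1)%E].

Definition log_concave_density (n : nat) (f : 'cV[R]_n -> \bar R) : Prop :=
  [/\ forall x, f x != -oo%E,
      econvex setT f &
      probability_density (fun x => expeR (- f x)%E)].

End Density.

Section EstimationControl.
Context {R : realType} (nx nz T : nat).

(* Times 0..T are 'I_T.+1; for t : 'I_T, the times t and t+1 are time_cur t and
   time_succ t. *)
Definition time_cur (t : 'I_T) : 'I_T.+1 := widen_ord (leqnSn T) t.
Definition time_succ (t : 'I_T) : 'I_T.+1 := lift ord0 t.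

(* Pairs (w, x), respectively (u, y), of trajectories. *)
Definition primal_space : lmodType R :=
  ({ffun 'I_T.+1 -> 'cV[R]_nx} * {ffun 'I_T.+1 -> 'cV[R]_nx})%type.
Definition dual_space : lmodType R :=
  ({ffun 'I_T.+1 -> 'cV[R]_nz} * {ffun 'I_T.+1 -> 'cV[R]_nx})%type.

Context (f : 'I_T.+1 -> 'cV[R]_nx -> \bar R)
        (g : 'I_T.+1 -> 'cV[R]_nz -> \bar R)
        (F : 'I_T -> 'M[R]_nx) (H : 'I_T.+1 -> 'M[R]_(nz, nx))
        (z : 'I_T.+1 -> 'cV[R]_nz).

Definition estimation_constraints (p : primal_space) : Prop :=
  let: (w, x) := p in
  (forall t : 'I_T,
      x (time_succ t) = F t *m x (time_cur t) + w (time_succ t)) /\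
  x ord0 = w ord0.

Definition estimation_objective (p : primal_space) : \bar R :=
  let: (w, x) := p in
  if `[< estimation_constraints p >]
  then (\sum_(t < T.+1) f t (w t) + \sum_(t < T.+1) g t (z t - H t *m x t)%R)%E
  else +oo%E.

Definition control_constraints (q : dual_space) : Prop :=
  let: (u, y) := q in
  (forall t : 'I_T,
      y (time_cur t) =
      (F t)^T *m y (time_succ t) + (H (time_cur t))^T *m u (time_cur t)) /\
  y ord_max = (H ord_max)^T *m u ord_max.

Definition control_objective (q : dual_space) : \bar R :=
  let: (u, y) := q in
  if `[< control_constraints q >]
  then (\sum_(t < T.+1) ((dotv (z t) (u t))%:E
          - convex_conjugate (f t) (y t) - convex_conjugate (g t) (u t)))%E
  else -oo%E.

(* The dual addition (scope dE) gives +oo - oo the value +oo. *)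
Definition lagrangian (p : primal_space) (q : dual_space) : \bar R :=
  let: (w, x) := p in let: (u, y) := q in
  (\sum_(t < T.+1) (f t (w t) + (dotv (z t) (u t))%:E
       - convex_conjugate (g t) (u t) - (dotv (u t) (H t *m x t)%R)%:E)
   + (dotv (y ord0) (x ord0 - w ord0)%R)%:E
   + \sum_(t < T)
       (dotv (y (time_succ t))
          (x (time_succ t) - F t *m x (time_cur t) - w (time_succ t))%R)%:E)%dE.

End EstimationControl.

(* Main.v *)
Require Import Defs.
From mathcomp Require Import all_boot all_order all_algebra.
From mathcomp Require Import all_classical all_reals all_analysis.
From mathcomp Require Import measurable_realfun ring lra.
Import Order.TTheory GRing.Theory Num.Theory.
Import numFieldNormedType.Exports.
Import DualAddTheory.
Local Open Scope classical_set_scope.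
Local Open Scope ring_scope.

Set Implicit Arguments.
Unset Strict Implicit.
Unset Printing Implicit Defensive.

(* The Lagrangian is the sum of the f_t(w_t), minus the sum of the g_t^*(u_t),
   plus a finite term that is affine in (w, x) and in (u, y) separately, with
   the value +oo, resp. -oo, forced by an infinite f_t(w_t), resp. g_t^*(u_t).
   Maximizing over the multiplier y enforces the state equation, and maximizing
   over u turns g_t^* into g_t^** = g_t (Fenchel-Moreau).  Summing by parts
   makes x the multiplier of the costate equation, and minimizing over w
   produces -f_t^*(y_t).  Being the exponent of a density matters only in that
   f_t and g_t are finite somewhere.

   Fenchel-Moreau is obtained by Moreau regularization: a convex lower
   semicontinuous proper g has a linear lower bound, so g + K |x - x0|^2
   attains its minimum; the first-order condition there yields an affine
   minorant of g whose value at x0 is as close to g(x0) as desired when K is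
   large. *)

(** * Attainment of minima by lower semicontinuous functions *)

Lemma compact_lsc_min (R : realType) (X : topologicalType) (A : set X)
    (h : X -> \bar R) :
  compact A -> A !=set0 -> lower_semicontinuous h ->
  exists2 x, A x & forall y, A y -> (h x <= h y)%E.
Proof.
move=> cA [a Aa] hlsc.
(* The sublevel sets of [h] at its own values are totally ordered by inclusion, hence a filter base;
   any cluster point of it is a minimizer. *)
pose F := filter_from A (fun y => [set x | A x /\ (h x <= h y)%E]).
have FF : ProperFilter F.
  apply: filter_from_proper; last by move=> y Ay; exists y.
  apply: filter_from_filter; first by exists a.
  move=> y z Ay Az.
  have [yz|/ltW zy] := leP (h y) (h z).
  - exists y => // x [Ax xy]; split; split => //; exact: le_trans yz.
  - exists z => // x [Ax xy]; split; split => //; exact: le_trans zy.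
have [|p [Ap clp]] := cA F FF; first by exists a => // x [].
exists p => // y Ay; rewrite leNgt; apply/negP => yp.
have [r yr rp] : exists2 r : R, (h y <= r%:E)%E & (r%:E < h p)%E.
  move: yp; case: (h y) => [s||]; last 2 first.
  - by rewrite ltNge leey.
  - case: (h p) => [s _|_|//]; last by exists 0; rewrite ?leNye ?ltry.
    by exists (s - 1); [rewrite leNye | rewrite lte_fin ltrBlDr ltrDl].
  - by move=> sp; exists s.
have [V Vp Vr] := hlsc _ _ rp.
have Fy : F [set x | A x /\ (h x <= h y)%E] by exists y.
have [x [[_ xy] Vx]] := clp _ _ Fy Vp.
by have := lt_le_trans (Vr _ Vx) (le_trans xy yr); rewrite ltxx.
Qed.

Lemma mx_norm_tr (R : realType) m n (A : 'M[R]_(m, n)) : `|A^T| = `|A|.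
Proof.
suff le k l (B : 'M[R]_(k, l)) : `|B^T| <= `|B|.
  by apply/eqP; rewrite eq_le le -{1}(trmxK A) le.
rewrite /Num.Def.normr/= !mx_normrE; apply/bigmax_leP; split=> [|[i j] _ /=].
  exact: bigmax_ge_id.
by rewrite mxE; apply/bigmax_geP; right; exists (j, i).
Qed.

(** Compactness comes from [bounded_closed_compact] on row vectors; [h] is carried there by the
    isometry [v |-> x0 + v^T]. *)
Lemma closed_ball_lsc_min (R : realType) n (h : 'cV[R]_n -> \bar R)
    (x0 : 'cV[R]_n) rho :
  0 <= rho -> lower_semicontinuous h ->
  exists2 x, `|x - x0| <= rho & forall y, `|y - x0| <= rho -> (h x <= h y)%E.
Proof.
move=> rho0 hlsc.
pose A : set 'rV[R]_n := [set v | `|v| <= rho].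
have cA : compact A.
  apply: bounded_closed_compact.
    exists rho; split=> [|M rhoM v /= /le_trans]; first exact: num_real.
    by apply; exact: ltW.
  apply: (@closed_comp _ _ (fun v : 'rV[R]_n => `|v|) [set r | r <= rho]).
    by move=> v _; exact: norm_continuous.
  exact: closed_le.
pose k (v : 'rV[R]_n) := h (x0 + v^T).
have klsc : lower_semicontinuous k.
  move=> v a /hlsc[V /nbhs_ballP[e e0 eV] Va].
  exists (ball v e); first exact: nbhsx_ballx.
  move=> w; rewrite -ball_normE /= => vw; apply/Va/eV.
  by rewrite -ball_normE/= opprD addrACA subrr add0r -linearB /= mx_norm_tr.
have [|v Av vmin] := compact_lsc_min cA _ klsc.
  by exists 0; rewrite /A/= normr0.
exists (x0 + v^T); first by rewrite addrC addKr mx_norm_tr.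
move=> y yrho; rewrite -[in leRHS](subrKC x0 y) -[y - x0]trmxK.
by apply: vmin; rewrite /A/= mx_norm_tr.
Qed.

(** * Convexity inequalities and the scalar product *)

Lemma econvexP (R : realType) (E : lmodType R) (h : E -> \bar R) :
  econvex setT h <->
  forall (x y : E) (a b l : R), 0 <= l <= 1 ->
    (h x <= a%:E)%E -> (h y <= b%:E)%E ->
    (h (l *: x + (1 - l) *: y)%R <= (l * a + (1 - l) * b)%:E)%E.
Proof.
split=> [hc x y a b l l01 xa yb|hc [x a] [y b] l].
  have [l0 l1] := andP l01.
  have := hc (x, a : R^o) (y, b : R^o) (Itv01 l0 l1).
  by rewrite !inE => /(_ _ _)[] //.
rewrite !inE => -[_ /= xa] [_ /= yb]; split => //=.
by apply: hc => //; rewrite ge0 le1.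
Qed.

Section dotv.
Variables (R : realType) (n : nat).
Implicit Types x y z : 'cV[R]_n.

Lemma dotvE x y : dotv x y = \sum_i x i 0 * y i 0.
Proof. by rewrite /dotv mxE; apply: eq_bigr => i _; rewrite mxE. Qed.

Lemma dotvC x y : dotv x y = dotv y x.
Proof. by rewrite !dotvE; apply: eq_bigr => i _; rewrite mulrC. Qed.

Lemma dotvDr x y z : dotv x (y + z) = dotv x y + dotv x z.
Proof. by rewrite /dotv mulmxDr mxE. Qed.

Lemma dotvZr x y a : dotv x (a *: y) = a * dotv x y.
Proof. by rewrite /dotv -scalemxAr mxE. Qed.

Lemma dotvNr x y : dotv x (- y) = - dotv x y.
Proof. by rewrite /dotv mulmxN mxE. Qed.

Lemma dotvBr x y z : dotv x (y - z) = dotv x y - dotv x z.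
Proof. by rewrite dotvDr dotvNr. Qed.

Lemma dotv0r x : dotv x 0 = 0.
Proof. by rewrite /dotv mulmx0 mxE. Qed.

Lemma dotvDl x y z : dotv (x + y) z = dotv x z + dotv y z.
Proof. by rewrite !(dotvC _ z) dotvDr. Qed.

Lemma dotvZl x y a : dotv (a *: x) y = a * dotv x y.
Proof. by rewrite !(dotvC _ y) dotvZr. Qed.

Lemma dotvNl x y : dotv (- x) y = - dotv x y.
Proof. by rewrite !(dotvC _ y) dotvNr. Qed.

Lemma dotvBl x y z : dotv (x - y) z = dotv x z - dotv y z.
Proof. by rewrite dotvDl dotvNl. Qed.

Lemma dotv0l x : dotv 0 x = 0.
Proof. by rewrite dotvC dotv0r. Qed.

(** The matrix norm is the largest absolute entry, so its square is one term of the sum of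
    squares. *)
Lemma sqr_norm_le_dotv x : `|x| ^+ 2 <= dotv x x.
Proof.
have dot0 : 0 <= dotv x x.
  by rewrite dotvE sumr_ge0// => i _; rewrite -expr2 sqr_ge0.
rewrite [`|x|]/Num.Def.normr/=.
have [->|/mx_norm_neq0[[i j] -> /=]] := eqVneq (mx_norm x) 0.
  by rewrite expr0n.
rewrite (ord1 j) dotvE (bigD1 i)//= real_normK ?num_real// -expr2 lerDl.
by rewrite sumr_ge0// => k _; rewrite -expr2 sqr_ge0.
Qed.

Lemma dotv_gt0 x : x != 0 -> 0 < dotv x x.
Proof.
by move=> x0; apply: lt_le_trans (sqr_norm_le_dotv x);
  rewrite exprn_gt0 ?normr_gt0.
Qed.

Lemma dotv_diag_continuous x0 : continuous (fun x => dotv (x - x0) (x - x0)).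
Proof.
have -> : (fun x => dotv (x - x0) (x - x0)) =
    (fun x => \sum_i (x i 0 - x0 i 0) * (x i 0 - x0 i 0)).
  by apply/funext => x; rewrite dotvE; apply: eq_bigr => i _; rewrite !mxE.
have c i : continuous (fun x : 'cV[R]_n => x i 0 - x0 i 0).
  move=> x; exact: (cvgB (@coord_continuous R n 1 i 0 x) (cvg_cst (x0 i 0))).
elim: (index_enum _) => [|i s IHs].
  under eq_fun do rewrite big_nil; exact: cst_continuous.
under eq_fun do rewrite big_cons.
by move=> x; exact: (cvgD (cvgM (c i x) (c i x)) (IHs x)).
Qed.

End dotv.

Lemma dotv_mulmx (R : realType) m n (A : 'M[R]_(m, n)) (x : 'cV_m) (y : 'cV_n) :
  dotv x (A *m y) = dotv (A^T *m x) y.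
Proof. by rewrite /dotv trmx_mul trmxK mulmxA. Qed.

(** * Affine minorants and the Fenchel-Moreau theorem *)

Section FenchelMoreau.
Variables (R : realType) (n : nat) (g : 'cV[R]_n -> \bar R).

Lemma young_ineq x y : ((dotv x y)%:E - g x <= convex_conjugate g y)%E.
Proof. by apply: ereal_sup_ubound; exists x. Qed.

Hypotheses (gNy : forall x, g x != -oo%E) (gconv : econvex setT g)
  (glsc : lower_semicontinuous g).
Variables (x1 : 'cV[R]_n) (c1 : R).
Hypothesis gx1 : g x1 = c1%:E.

Lemma econvex_lsc_linear_minorant x0 : exists A B : R,
  0 <= B /\ forall x, ((- A - B * `|x - x0|)%:E <= g x)%E.
Proof.
have [xm xm1 xmin] := @closed_ball_lsc_min R n g x1 1 ler01 glsc.
have : (g xm <= c1%:E)%E by rewrite -gx1 xmin// subrr normr0.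
case gxm : (g xm) => [m||]; [|by rewrite leye_eq|];
  last by have := gNy xm; rewrite gxm.
rewrite lee_fin => mc1.
(* The bound [m - (c1 - m) * |x - x1|] is recentred at [x0] by the triangle inequality. *)
exists (- m + (c1 - m) * `|x0 - x1|), (c1 - m); rewrite subr_ge0; split=> // x.
apply: (@le_trans _ _ (m - (c1 - m) * `|x - x1|)%:E).
  rewrite lee_fin; have : `|x - x1| <= `|x - x0| + `|x0 - x1|.
    exact: ler_distD.
  nra.
(* Beyond the unit ball around x1, convexity on the segment from x1 to x
   transfers the lower bound m from the unit sphere. *)
have [d1|d1] := leP `|x - x1| 1.
  apply: le_trans (xmin x d1); rewrite gxm lee_fin.
  by have := normr_ge0 (x - x1); nra.
case gx : (g x) => [c||]; [|by rewrite leey|by have := gNy x; rewrite gx].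
have d0 : 0 < `|x - x1| by apply: lt_trans d1.
set d := `|x - x1| in d0 d1 *.
have l01 : 0 <= d^-1 <= 1 by rewrite invr_ge0 ltW//= invf_le1// ltW.
have gl : (g (d^-1 *: x + (1 - d^-1) *: x1)%R <=
    (d^-1 * c + (1 - d^-1) * c1)%:E)%E.
  by move/econvexP : gconv; apply; rewrite // ?gx ?gx1.
have := le_trans (xmin _ _) gl; rewrite gxm lee_fin => /(_ _)/wrap[].
  rewrite scalerBl scale1r addrCA addrAC subrr add0r.
  rewrite -scalerBr normrZ gtr0_norm ?invr_gt0// mulVf// lt0r_neq0//.
rewrite -(ler_pM2l d0) mulrDr !mulrA mulrBr mulr1 divff ?lt0r_neq0// mul1r => h.
by rewrite lee_fin; nra.
Qed.

Lemma quadratic_perturbation_min x0 K : 0 < K -> exists x c, g x = c%:E /\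
  forall y, ((c + K * dotv (x - x0) (x - x0))%:E
             <= g y + (K * dotv (y - x0) (y - x0))%:E)%E.
Proof.
move=> K0; have [A [B [B0 gAB]]] := econvex_lsc_linear_minorant x0.
pose q x := dotv (x - x0) (x - x0).
pose h x := (g x + (K * q x)%:E)%E.
have hlsc : lower_semicontinuous h.
  move=> x a ax.
  (* The slack [e] is what the continuous quadratic term may lose near [x]. *)
  have : exists2 e, 0 < e & ((a - K * q x + e)%:E < g x)%E.
    move: ax; rewrite /h; case: (g x) (gNy x) => [b||//] _.
    - rewrite -EFinD !lte_fin => ab.
      by exists ((b - (a - K * q x)) / 2); [lra|rewrite lte_fin; lra].
    - by exists 1; rewrite ?ltry.
  move=> [e e0 /glsc[V Vx Va]].
  have cK : continuous (fun x => K * q x).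
    by move=> y; exact: (cvgM (cvg_cst K) (@dotv_diag_continuous R n x0 y)).
  have := cK x => /cvgrPdist_lt/(_ e e0) qe.
  exists (V `&` [set y | `|K * q x - K * q y| < e]); first exact: filterI.
  move=> y [/Va Vy /=]; rewrite ltr_norml => /andP[_ qy].
  rewrite /h; case: (g y) Vy (gNy y) => [b||//] Vy _.
    by move: Vy; rewrite -EFinD !lte_fin => Vy; lra.
  by rewrite addye ?ltry.
pose C := c1 + K * q x1.
(* The ball contains [x1], where [h] equals [C]. Outside it [d = |y - x0|] satisfies [d >= 1] and
   [K * d >= B + |A + C|], so [h y >= - A - B * d + K * d ^+ 2 >= C]: the minimum over the ball is
   global. *)
pose rho := `|x1 - x0| + 1 + (B + `|A + C|) / K.
have hK : 0 <= (B + `|A + C|) / K by rewrite divr_ge0 ?addr_ge0// ltW.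
have rho0 : 0 <= rho by rewrite !addr_ge0.
have [x _ xmin] := closed_ball_lsc_min x0 rho0 hlsc.
have hx1 : h x1 = C%:E by rewrite /h gx1.
have hxC : (h x <= C%:E)%E.
  by rewrite -hx1; apply: xmin; rewrite /rho -addrA lerDl addr_ge0.
case gx : (g x) => [c||]; last by have := gNy x; rewrite gx.
- exists x, c; split=> // y.
  have -> : (c + K * dotv (x - x0) (x - x0))%:E = h x by rewrite /h gx.
  have [|yrho] := leP `|y - x0| rho; first exact: xmin.
  apply: le_trans hxC _.
  apply: (@le_trans _ _ ((- A - B * `|y - x0|)%:E + (K * q y)%:E)%E); last first.
    exact: leeD.
  rewrite -EFinD lee_fin.
  apply: (@le_trans _ _ (- A - B * `|y - x0| + K * `|y - x0| ^+ 2)); last first.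
    by rewrite lerD2l ler_pM2l// sqr_norm_le_dotv.
  set d := `|y - x0| in yrho *.
  have d1 : 1 <= d by move: yrho hK (normr_ge0 (x1 - x0)); rewrite /rho; lra.
  have : B + `|A + C| <= K * d.
    rewrite mulrC -ler_pdivrMr//; move: yrho
      (normr_ge0 (x1 - x0)); rewrite /rho; lra.
  have := ler_norm (A + C); have := normr_ge0 (A + C).
  move: `|A + C| => E E0 ACE BE.
  have : 0 <= (K * d - B - E) * d by apply: mulr_ge0; lra.
  rewrite expr2; nra.
- by move: hxC; rewrite /h gx leye_eq.
Qed.

(* Letting l -> 0 in the minimality along the segment from x to y gives the
   first-order condition: 2 K (x0 - x) is a subgradient of g at x. *)
Lemma subgradient_of_min x0 K x c : g x = c%:E ->
  (forall y, ((c + K * dotv (x - x0) (x - x0))%:E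
             <= g y + (K * dotv (y - x0) (y - x0))%:E)%E) -> 0 < K ->
  forall y, ((c + 2 * K * dotv (x0 - x) (y - x))%:E <= g y)%E.
Proof.
move=> gx xmin K0 y.
case gy : (g y) => [b||]; [|by rewrite leey|by have := gNy y; rewrite gy].
rewrite lee_fin -subr_ge0.
set P := K * dotv (y - x) (y - x); set e := (X in 0 <= X).
have P0 : 0 <= P.
  by rewrite mulr_ge0 ?(ltW K0)// (le_trans _ (sqr_norm_le_dotv _))// sqr_ge0.
have step l : 0 < l -> l <= 1 -> 0 <= e + l * P.
  move=> l0 l1; have l01 : 0 <= l <= 1 by rewrite l1 ltW.
  have gl : (g (l *: y + (1 - l) *: x)%R <= (l * b + (1 - l) * c)%:E)%E.
    by move/econvexP : gconv; apply; rewrite // ?gx ?gy.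
  have := le_trans (xmin _) (leeD2r _ gl).
  rewrite -EFinD lee_fin.
  have -> : l *: y + (1 - l) *: x - x0 = (x - x0) + l *: (y - x).
    by rewrite scalerBl scale1r scalerBr addrCA [RHS]addrAC.
  rewrite /P /e -(opprB x x0) dotvNl.
  move: (x - x0) (y - x) => u D.
  rewrite !(dotvDl, dotvDr, dotvZl, dotvZr) (dotvC D u) => H.
  rewrite -(pmulr_rge0 _ l0); move: H.
  by set p := dotv u u; set q := dotv u D; set s := dotv D D => H; nra.
rewrite leNgt; apply/negP => e0.
have s0 : 0 < P - e + 1 by lra.
(* An explicit [l] in place of the limit: if [e < 0], it lies in (0, 1) and makes
   [(P - e + 1) * (e + l * P)] equal to [e * (1 - e) < 0]. *)
have := step (- e / (P - e + 1)).
rewrite divr_gt0 ?oppr_gt0// ler_pdivrMr// mul1r => /(_ isT).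
have -> : - e <= P - e + 1 by lra.
move=> /(_ isT); apply/negP; rewrite -ltNge -(pmulr_rlt0 _ s0) mulrDr.
have -> : (P - e + 1) * (- e / (P - e + 1) * P) = - e * P.
  by rewrite mulrA (mulrC (P - e + 1)) divfK ?lt0r_neq0.
nra.
Qed.

(* The Moreau envelopes of g increase to g by lower semicontinuity, and the
   subgradient at a minimizer is an affine minorant above the envelope. *)
Lemma fenchel_moreau x0 r : (r%:E < g x0)%E ->
  exists y, (r%:E < (dotv x0 y)%:E - convex_conjugate g y)%E.
Proof.
move=> rx0; have [A [B [B0 gAB]]] := econvex_lsc_linear_minorant x0.
have [V /nbhs_ballP[d /= d0 dV] Vr] := glsc rx0.
(* If the minimizer [x] is within [d] of [x0], then [g x > r] already. Otherwise, with
   [D = |x - x0| >= d], this [K] gives [K * D ^+ 2 >= B * D + |r| + |A| + 1], which outweighs the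
   linear bound [g x >= - A - B * D]. *)
pose K := (B + (`|r| + `|A| + 1) / d) / d.
have K0 : 0 < K.
  by rewrite divr_gt0// ltr_wpDl// divr_gt0// ltr_wpDl// addr_ge0.
have [x [c [gx xmin]]] := quadratic_perturbation_min x0 K0.
exists (2 * K *: (x0 - x)).
have sub := subgradient_of_min gx xmin K0.
set y := _ *: _.
have cy : (convex_conjugate g y <= (dotv x y - c)%:E)%E.
  apply/ereal_supP => _ [v _ <-].
  have := sub v; case: (g v) (gNy v) => [b||//] _; last by rewrite leNye.
  rewrite !lee_fin dotvBr /y !dotvZr ![dotv _ (x0 - x)]dotvC; nra.
apply: (@lt_le_trans _ _ ((dotv x0 y)%:E - (dotv x y - c)%:E)%E); last first.
  exact: leeB.
rewrite -EFinB lte_fin opprB addrCA addrA -addrA -dotvBl /y dotvZr.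
have q0 : `|x - x0| ^+ 2 <= dotv (x0 - x) (x0 - x).
  by rewrite distrC sqr_norm_le_dotv.
have [xd|xd] := ltP `|x0 - x| d.
  have : (r%:E < g x)%E by apply/Vr/dV; rewrite -ball_normE.
  have : 0 <= K * dotv (x0 - x) (x0 - x).
    by rewrite mulr_ge0 ?(ltW K0)// (le_trans _ q0)// sqr_ge0.
  by rewrite gx lte_fin; lra.
have := gAB x; rewrite gx lee_fin.
rewrite distrC in xd; set D := `|x - x0| in xd q0 *.
have KdE : K * d = B + (`|r| + `|A| + 1) / d by rewrite /K divfK ?lt0r_neq0.
have KD2 : K * D ^+ 2 <= K * dotv (x0 - x) (x0 - x) by rewrite ler_pM2l.
have D0 : 0 < D by lra.
have KD : B * D + (`|r| + `|A| + 1) <= K * D ^+ 2.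
  apply: (@le_trans _ _ (K * d * D)).
    rewrite KdE mulrDl lerD2l mulrAC ler_pdivlMr// ler_pM2l//.
  by rewrite expr2 mulrA ler_wpM2r ?ler_wpM2l// ltW.
have := ler_norm r; have := ler_norm A.
have := normr_ge0 r; have := normr_ge0 A.
nra.
Qed.

End FenchelMoreau.

(** * Real approximation of extended reals, and properness of densities *)

Lemma lee_below_real (R : realType) (x y : \bar R) :
  (forall r : R, (r%:E < x)%E -> (r%:E <= y)%E) -> (x <= y)%E.
Proof.
case: x => [x||] xy; last by rewrite leNye.
- case: y xy => [y||] xy; first last.
  + by have := xy (x - 1); rewrite lte_fin ltrBlDr ltrDl ltr01 => /(_ isT).
  + by rewrite leey.
  rewrite lee_fin leNgt; apply/negP => yx.
  have := xy ((x + y) / 2); rewrite lte_fin lee_fin => /(_ _)/wrap[]; lra.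
- case: y xy => [y|//|] xy; last by have := xy 0 (ltry _).
  by have := xy (y + 1) (ltry _); rewrite lee_fin gerDl ler10.
Qed.

Lemma lee_above_real (R : realType) (x y : \bar R) :
  (forall r : R, (x < r%:E)%E -> (y <= r%:E)%E) -> (y <= x)%E.
Proof.
move=> xy; rewrite -leeN2; apply: lee_below_real => r rx.
by rewrite leeNr -EFinN xy// EFinN lteNr.
Qed.

(** Distributes a bound on a sum over its terms, so that the supremum in each term can be
    approximated separately. An infinite term absorbs any deficit; otherwise the excess is shared
    out. *)
Lemma real_below_sum (R : realType) (I : finType) (S : I -> \bar R) (M : R) :
  (forall i, S i != -oo%E) -> (M%:E < \sum_i S i)%E ->
  exists m : I -> R, (forall i, ((m i)%:E < S i)%E) /\ M <= \sum_i m i.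
Proof.
move=> SNy MS.
have [[j Sj]|Sfin] := pselect (exists j, S j = +oo%E).
  pose m' i := fine (S i) - 1.
  exists (fun i => if i == j then M - \sum_(k | k != j) m' k else m' i).
  split=> [i|].
    case: eqP => [->|_]; first by rewrite Sj ltry.
    by rewrite /m'; case: (S i) (SNy i) => [s|_|//];
      rewrite ?ltry// lte_fin gtrBl.
  rewrite (bigD1 j)//= eqxx.
  under [X in _ + X]eq_bigr => i /negbTE -> do [].
  by rewrite subrK.
have SE i : S i = (fine (S i))%:E.
  rewrite fineK// fin_numE SNy/=; apply/eqP => Si; apply: Sfin; by exists i.
move: MS; under eq_bigr do rewrite SE; rewrite sumEFin lte_fin => MS.
(* The successor keeps the denominator nonzero when [I] is empty. *)
pose e := (\sum_i fine (S i) - M) / #|I|.+1%:R.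
have e0 : 0 < e by rewrite divr_gt0// subr_gt0.
exists (fun i => fine (S i) - e); split=> [i|].
  by rewrite [ltRHS]SE lte_fin gtrBl.
have eE : e * #|I|%:R + e = \sum_i fine (S i) - M.
  by rewrite -{2}(mulr1 e) -mulrDr natr1 divfK// pnatr_eq0.
by rewrite sumrB sumr_const -mulr_natr; lra.
Qed.

Definition eproper (R : realType) (V : Type) (h : V -> \bar R) :=
  (forall x, h x != -oo%E) /\ exists x c, h x = c%:E.

(** Otherwise [h] is identically [+oo], and the density vanishes everywhere. *)
Lemma log_concave_density_proper (R : realType) n (h : 'cV[R]_n -> \bar R) :
  log_concave_density h -> eproper h.
Proof.
move=> [hNy _ [_ _ int1]]; split=> //; apply/not_existsP => hy.
have {}hy x : h x = +oo%E.
  case hx : (h x) (hNy x) => [c|//|//] _.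
  by case: (hy x); exists c.
(* lebesgue_tuple is not packaged as a measure, so the integral of 0 is not
   evaluated: it is N - N for some extended real N, hence not 1. *)
move: int1; rewrite /integral.
set p := (X in X \_ setT); have -> : p = cst 0%E.
  by apply/funext => s; rewrite /p hy.
have -> : forall X : Type, (((cst 0 : X -> \bar R) \_ setT)^\- =
    ((cst 0 : X -> \bar R) \_ setT)^\+)%E.
  by move=> X; apply/funext => s; rewrite funeposE funenegE patch_setT/= oppr0.
case: (@ereal_sup R _) => [a|//|//].
by rewrite -EFinB subrr => -[/eqP]; rewrite eq_sym oner_eq0.
Qed.

(** * Conjugates of proper functions *)

Section conjugate.
Variables (R : realType) (n : nat) (h : 'cV[R]_n -> \bar R).
Hypothesis hP : eproper h.

Lemma convex_conjugate_neqNy y : convex_conjugate h y != -oo%E.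
Proof.
have [_ [x [c hx]]] := hP; apply/eqP => hy.
by have := young_ineq h x y; rewrite hx hy -EFinB leeNy_eq.
Qed.

Lemma econvex_conjugate : econvex setT (convex_conjugate h).
Proof.
apply/econvexP => y1 y2 b1 b2 l /andP[l0 l1] h1 h2.
apply/ereal_supP => _ [x _ <-].
have := le_trans (young_ineq h x y1) h1.
have := le_trans (young_ineq h x y2) h2.
case hx : (h x) => [a||]; last 2 first.
- by move=> _ _; exact: leNye.
- by have := hP.1 x; rewrite hx.
rewrite -!EFinB !lee_fin dotvDr !dotvZr => k2 k1.
have := ler_wpM2l l0 k1; have := @ler_wpM2l _ (1 - l) _ _ _ k2.
rewrite subr_ge0 => /(_ l1); nra.
Qed.

(** Properness excludes the value [-oo] of the conjugate, and the strict bound of [fenchel_moreau]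
    excludes [+oo]. *)
Lemma fenchel_moreau_proper x r :
  econvex setT h -> lower_semicontinuous h -> (r%:E < h x)%E ->
  exists y b, convex_conjugate h y = b%:E /\ r < dotv x y - b.
Proof.
have [hNy [x1 [c1 hx1]]] := hP; move=> hconv hlsc rx.
have [y] := fenchel_moreau hNy hconv hlsc hx1 rx.
case hy : (convex_conjugate h y) (convex_conjugate_neqNy y) => [b|//|//] _.
by rewrite -EFinB lte_fin; exists y, b.
Qed.

End conjugate.

(** Drives the case analyses on the Lagrangian: an infinite term can decide its value, and otherwise
    real arithmetic applies. *)
Lemma fin_family (R : realType) (I : Type) (S : I -> \bar R) :
  (forall i, S i != -oo%E) -> (exists i, S i = +oo%E) \/
  exists s : I -> R, forall i, S i = (s i)%:E.
Proof.
move=> SNy; have [|Sfin] := pselect (exists i, S i = +oo%E); [by left|right].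
exists (fun i => fine (S i)) => i.
by rewrite fineK// fin_numE SNy/=; apply/eqP => Si; apply: Sfin; exists i.
Qed.

(** * The Lagrangian, its affine part and the two constraint residuals *)

Section lagrangian.
Variables (R : realType) (nx nz T : nat).
Variables (f : 'I_T.+1 -> 'cV[R]_nx -> \bar R)
  (g : 'I_T.+1 -> 'cV[R]_nz -> \bar R)
  (F : 'I_T -> 'M[R]_nx) (H : 'I_T.+1 -> 'M[R]_(nz, nx))
  (z : 'I_T.+1 -> 'cV[R]_nz).
Implicit Types (w x y : {ffun 'I_T.+1 -> 'cV[R]_nx})
  (u : {ffun 'I_T.+1 -> 'cV[R]_nz}).

Local Notation cur := (@time_cur T).
Local Notation succ := (@time_succ T).
Local Notation L := (lagrangian f g F H z).

Definition state_residual w x y : R :=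
  dotv (y ord0) (x ord0 - w ord0) +
  \sum_(t < T) dotv (y (succ t)) (x (succ t) - F t *m x (cur t) - w (succ t)).

Definition costate_residual u y x : R :=
  \sum_(t < T) dotv (y (cur t) - ((F t)^T *m y (succ t) +
                                  (H (cur t))^T *m u (cur t))) (x (cur t)) +
  dotv (y ord_max - (H ord_max)^T *m u ord_max) (x ord_max).

(** The terms of the Lagrangian free of [f] and conjugates, with [u t] paired with
    [z t - H t *m x t], the argument of [g t] in the estimation problem. *)
Definition coupling w x u y : R :=
  \sum_(t < T.+1) dotv (z t - H t *m x t) (u t) + state_residual w x y.

(* Summation by parts. *)
Lemma coupling_costateE w x u y :
  coupling w x u y = \sum_(t < T.+1) dotv (z t) (u t)
    - \sum_(t < T.+1) dotv (w t) (y t) + costate_residual u y x.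
Proof.
rewrite /coupling /state_residual /costate_residual.
have Hx t : dotv (z t - H t *m x t) (u t) =
    dotv (z t) (u t) - dotv (u t) (H t *m x t).
  by rewrite dotvBl (dotvC (H t *m x t)).
under eq_bigr do rewrite Hx; rewrite sumrB.
have -> : \sum_(t < T.+1) dotv (u t) (H t *m x t) =
    \sum_(t < T) dotv (u (cur t)) (H (cur t) *m x (cur t)) +
    dotv (u ord_max) (H ord_max *m x ord_max) by rewrite big_ord_recr.
have -> : \sum_(t < T.+1) dotv (w t) (y t) =
    dotv (w ord0) (y ord0) + \sum_(t < T) dotv (w (succ t)) (y (succ t)).
  by rewrite big_ord_recl.
(* The index shift: one sum over all times, split at its first or at its last term. *)
have : dotv (y ord0) (x ord0) + \sum_(t < T) dotv (y (succ t)) (x (succ t)) =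
    \sum_(t < T) dotv (y (cur t)) (x (cur t)) + dotv (y ord_max) (x ord_max).
  transitivity (\sum_(t < T.+1) dotv (y t) (x t)).
    by rewrite big_ord_recl.
  by rewrite big_ord_recr.
have -> : \sum_(t < T) dotv (y (succ t))
      (x (succ t) - F t *m x (cur t) - w (succ t)) =
    \sum_(t < T) dotv (y (succ t)) (x (succ t)) -
    \sum_(t < T) dotv (y (succ t)) (F t *m x (cur t)) -
    \sum_(t < T) dotv (w (succ t)) (y (succ t)).
  by rewrite -!sumrB; apply: eq_bigr => t _; rewrite !dotvBr (dotvC (w _)).
have -> : \sum_(t < T) dotv (y (cur t) - ((F t)^T *m y (succ t) +
      (H (cur t))^T *m u (cur t))) (x (cur t)) =
    \sum_(t < T) dotv (y (cur t)) (x (cur t)) -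
    \sum_(t < T) dotv (y (succ t)) (F t *m x (cur t)) -
    \sum_(t < T) dotv (u (cur t)) (H (cur t) *m x (cur t)).
  rewrite -!sumrB; apply: eq_bigr => t _.
  by rewrite dotvBl dotvDl !dotv_mulmx opprD addrA.
rewrite !dotvBr dotvBl (dotvC (w ord0)) -dotv_mulmx.
lra.
Qed.

Lemma coupling_conv_primal w1 x1 w2 x2 u y l :
  coupling (l *: w1 + (1 - l) *: w2) (l *: x1 + (1 - l) *: x2) u y =
  l * coupling w1 x1 u y + (1 - l) * coupling w2 x2 u y.
Proof.
rewrite /coupling /state_residual !mulrDr !mulr_sumr addrACA -big_split/=.
rewrite addrACA -!big_split/=; congr (_ + (_ + _)).
- apply: eq_bigr => t _; rewrite !ffunE mulmxDr -!scalemxAr.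
  by rewrite !(dotvBl, dotvDl, dotvNl, dotvZl); ring.
- by rewrite !ffunE !(dotvBr, dotvDr, dotvNr, dotvZr); ring.
- apply: eq_bigr => t _; rewrite !ffunE mulmxDr -!scalemxAr.
  by rewrite !(dotvBr, dotvDr, dotvNr, dotvZr); ring.
Qed.

Lemma coupling_conv_dual w x u1 y1 u2 y2 l :
  coupling w x (l *: u1 + (1 - l) *: u2) (l *: y1 + (1 - l) *: y2) =
  l * coupling w x u1 y1 + (1 - l) * coupling w x u2 y2.
Proof.
rewrite /coupling /state_residual !mulrDr !mulr_sumr addrACA -big_split/=.
rewrite addrACA -!big_split/=; congr (_ + (_ + _)).
- by apply: eq_bigr => t _; rewrite !ffunE dotvDr !dotvZr; ring.
- by rewrite !ffunE dotvDl !dotvZl.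
- by apply: eq_bigr => t _; rewrite !ffunE dotvDl !dotvZl.
Qed.

(** By homogeneity, scaling the multiplier of a violated constraint gives the Lagrangian any
    prescribed real value. *)
Lemma state_residualZ w x y s :
  state_residual w x (s *: y) = s * state_residual w x y.
Proof.
rewrite /state_residual mulrDr mulr_sumr !ffunE dotvZl; congr (_ + _).
by apply: eq_bigr => t _; rewrite !ffunE dotvZl.
Qed.

Lemma costate_residualZ u y x s :
  costate_residual u y (s *: x) = s * costate_residual u y x.
Proof.
rewrite /costate_residual mulrDr mulr_sumr !ffunE dotvZr; congr (_ + _).
by apply: eq_bigr => t _; rewrite !ffunE dotvZr.
Qed.

Lemma state_residual_eq0 w x y :
  estimation_constraints F (w, x) -> state_residual w x y = 0.
Proof.
move=> [xw x0]; rewrite /state_residual x0 subrr dotv0r add0r big1// => t _.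
by rewrite xw (addrC (F t *m _)) addrK subrr dotv0r.
Qed.

Lemma costate_residual_eq0 u y x :
  control_constraints F H (u, y) -> costate_residual u y x = 0.
Proof.
move=> [yu yT]; rewrite /costate_residual yT subrr dotv0l addr0 big1// => t _.
by rewrite -yu subrr dotv0l.
Qed.

Lemma succ_inj : injective succ. Proof. exact: lift_inj. Qed.

Lemma cur_inj : injective cur.
Proof. by move=> s t /(congr1 val) /= st; apply: val_inj. Qed.

(** The multiplier is the residual of one violated equation, placed at the time paired with that
    equation and zero elsewhere; the pairing is then its squared length. *)
Lemma state_residual_gt0 w x :
  ~ estimation_constraints F (w, x) -> exists y, 0 < state_residual w x y.
Proof.
move=> xw; have [x0|x0] := eqVneq (x ord0) (w ord0); last first.
  exists [ffun t => if t == ord0 then x ord0 - w ord0 else 0].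
  rewrite /state_residual ffunE eqxx big1 ?addr0 ?dotv_gt0 ?subr_eq0// => t _.
  by rewrite ffunE dotv0l.
have [t /eqP xt] : exists t : 'I_T,
    x (succ t) <> F t *m x (cur t) + w (succ t).
  by apply/existsNP => xt; apply: xw.
pose r := x (succ t) - F t *m x (cur t) - w (succ t).
exists [ffun s => if s == succ t then r else 0].
rewrite /state_residual x0 subrr dotv0r add0r (bigD1 t)//= ffunE eqxx big1.
  by rewrite addr0 dotv_gt0// /r -addrA -opprD subr_eq0.
by move=> s st; rewrite ffunE (inj_eq succ_inj) (negbTE st) dotv0l.
Qed.

(** As for the state equation, with the terminal condition in the role of the initial one. *)
Lemma costate_residual_gt0 u y :
  ~ control_constraints F H (u, y) -> exists x, 0 < costate_residual u y x.
Proof.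
move=> yu; have [yT|yT] := eqVneq (y ord_max) ((H ord_max)^T *m u ord_max).
  have [t /eqP yt] : exists t : 'I_T, y (cur t) <>
      (F t)^T *m y (succ t) + (H (cur t))^T *m u (cur t).
    by apply/existsNP => yt; apply: yu.
  pose r := y (cur t) - ((F t)^T *m y (succ t) + (H (cur t))^T *m u (cur t)).
  exists [ffun s => if s == cur t then r else 0].
  rewrite /costate_residual yT subrr dotv0l addr0 (bigD1 t)//= ffunE eqxx big1.
    by rewrite addr0 dotv_gt0// subr_eq0.
  by move=> s st; rewrite ffunE (inj_eq cur_inj) (negbTE st) dotv0r.
exists [ffun s => if s == ord_max then
  y ord_max - (H ord_max)^T *m u ord_max else 0].
rewrite /costate_residual ffunE eqxx big1 ?add0r ?dotv_gt0 ?subr_eq0// => t _.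
by rewrite ffunE -val_eqE/= ltn_eqF// dotv0r.
Qed.

Lemma lagrangian_y w x u y t : f t (w t) = +oo%E -> L (w, x) (u, y) = +oo%E.
Proof.
move=> ft; rewrite /lagrangian [X in (X + _ + _)%dE](_ : _ = +oo%E).
  by rewrite dsumEFin.
apply/eqP; rewrite desum_eqy; apply/existsP; exists t; rewrite ft.
by case: (convex_conjugate _ _).
Qed.

(** Under dual addition [-oo] prevails only if no summand is [+oo]; hence the finiteness of every
    [f t (w t)]. *)
Lemma lagrangian_Ny w x u y (a : 'I_T.+1 -> R) t :
  (forall t, f t (w t) = (a t)%:E) ->
  (forall t, convex_conjugate (g t) (u t) != -oo%E) ->
  convex_conjugate (g t) (u t) = +oo%E -> L (w, x) (u, y) = -oo%E.
Proof.
move=> fa gNy gt; rewrite /lagrangian [X in (X + _ + _)%dE](_ : _ = -oo%E).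
  by rewrite dsumEFin.
apply/eqP; rewrite desum_eqNy.
  by apply/existsP; exists t; rewrite fa gt.
by move=> s; rewrite fa; case: (convex_conjugate _ _) (gNy s).
Qed.

Lemma lagrangian_fin w x u y (a b : 'I_T.+1 -> R) :
  (forall t, f t (w t) = (a t)%:E) ->
  (forall t, convex_conjugate (g t) (u t) = (b t)%:E) ->
  L (w, x) (u, y) =
  (\sum_(t < T.+1) a t - \sum_(t < T.+1) b t + coupling w x u y)%:E.
Proof.
move=> fa gb; rewrite /lagrangian.
under eq_bigr => t _ do rewrite fa gb.
rewrite !dsumEFin -!dEFinD; congr (_%:E).
rewrite /coupling /state_residual !addrA; congr (_ + _ + _).
rewrite -sumrB -big_split/=; apply: eq_bigr => t _.
by rewrite dotvBl (dotvC (H t *m x t)); ring.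
Qed.

End lagrangian.

(** * Convexity-concavity, and the supremum and infimum of the Lagrangian *)

Section duality.
Variables (R : realType) (nx nz T : nat).
Variables (f : 'I_T.+1 -> 'cV[R]_nx -> \bar R)
  (g : 'I_T.+1 -> 'cV[R]_nz -> \bar R)
  (F : 'I_T -> 'M[R]_nx) (H : 'I_T.+1 -> 'M[R]_(nz, nx))
  (z : 'I_T.+1 -> 'cV[R]_nz).
Hypotheses (fP : forall t, eproper (f t)) (gP : forall t, eproper (g t)).
Implicit Types (w x y : {ffun 'I_T.+1 -> 'cV[R]_nx})
  (u : {ffun 'I_T.+1 -> 'cV[R]_nz}).

Local Notation L := (lagrangian f g F H z).

Let conjfNy t v : convex_conjugate (f t) v != -oo%E.
Proof. exact: convex_conjugate_neqNy. Qed.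

Let conjgNy u t : convex_conjugate (g t) (u t) != -oo%E.
Proof. exact: convex_conjugate_neqNy. Qed.

Lemma f_cases w : (exists t, f t (w t) = +oo%E) \/
  exists a : 'I_T.+1 -> R, forall t, f t (w t) = (a t)%:E.
Proof. by apply: fin_family => t; exact: (fP t).1. Qed.

Lemma conjg_cases u : (exists t, convex_conjugate (g t) (u t) = +oo%E) \/
  exists b : 'I_T.+1 -> R, forall t, convex_conjugate (g t) (u t) = (b t)%:E.
Proof. exact/fin_family/conjgNy. Qed.

Lemma lagrangian_econvex q : (forall t, econvex setT (f t)) ->
  econvex setT (fun p => L p q).
Proof.
move=> fconv; case: q => u y.
apply/econvexP => -[w1 x1] [w2 x2] c1 c2 l l01.
have [[t ft]|[a1 fa1]] := f_cases w1.
  by rewrite (lagrangian_y _ _ _ _ _ _ _ ft) leye_eq.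
have [[t ft]|[a2 fa2]] := f_cases w2.
  by rewrite [in X in _ -> X -> _](lagrangian_y _ _ _ _ _ _ _ ft) leye_eq.
rewrite [l *: _ + _](_ : _ =
  (l *: w1 + (1 - l) *: w2, l *: x1 + (1 - l) *: x2))//.
have le_a t : (f t ((l *: w1 + (1 - l) *: w2) t) <=
    (l * a1 t + (1 - l) * a2 t)%:E)%E.
  rewrite !ffunE; move/econvexP : (fconv t); apply => //.
    by rewrite fa1.
  by rewrite fa2.
(* Convexity of the [f t] makes them finite at the combination, so an infinite conjugate there
   yields [-oo] and not [+oo]. *)
have [[t ft]|[a fa]] := f_cases (l *: w1 + (1 - l) *: w2).
  by have := le_a t; rewrite ft leye_eq.
have [[t gt]|[b gb]] := conjg_cases u.
  by move=> _ _; rewrite (lagrangian_Ny _ _ _ _ _ fa (conjgNy _) gt)// leNye.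
rewrite (lagrangian_fin _ _ _ _ _ fa1 gb) (lagrangian_fin _ _ _ _ _ fa2 gb).
rewrite (lagrangian_fin _ _ _ _ _ fa gb).
rewrite !lee_fin coupling_conv_primal => h1 h2.
have : \sum_(t < T.+1) a t <=
    l * \sum_(t < T.+1) a1 t + (1 - l) * \sum_(t < T.+1) a2 t.
  rewrite !mulr_sumr -big_split/=; apply: ler_sum => t _.
  by rewrite -lee_fin -fa.
have [l0 l1] := andP l01.
have := ler_wpM2l l0 h1; have := @ler_wpM2l _ (1 - l) _ _ _ h2.
by rewrite subr_ge0 => /(_ l1); lra.
Qed.

Lemma lagrangian_econcave p : econcave setT (L p).
Proof.
case: p => w x; apply/econvexP => -[u1 y1] [u2 y2] c1 c2 l l01.
rewrite [l *: _ + _](_ : _ =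
  (l *: u1 + (1 - l) *: u2, l *: y1 + (1 - l) *: y2))//.
have [[t ft]|[a fa]] := f_cases w.
  by move=> _ _; rewrite (lagrangian_y _ _ _ _ _ _ _ ft) leNye.
have [[t gt]|[b1 gb1]] := conjg_cases u1.
  by rewrite (lagrangian_Ny _ _ _ _ _ fa (conjgNy _) gt)// leye_eq.
have [[t gt]|[b2 gb2]] := conjg_cases u2.
  rewrite [in X in _ -> X -> _](lagrangian_Ny _ _ _ _ _ fa (conjgNy _) gt).
  by rewrite leye_eq.
have le_b t : (convex_conjugate (g t) ((l *: u1 + (1 - l) *: u2) t) <=
    (l * b1 t + (1 - l) * b2 t)%:E)%E.
  rewrite !ffunE; move/econvexP : (econvex_conjugate (gP t)); apply => //.
    by rewrite gb1.
  by rewrite gb2.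
have [[t gt]|[b gb]] := conjg_cases (l *: u1 + (1 - l) *: u2).
  by have := le_b t; rewrite gt leye_eq.
rewrite (lagrangian_fin _ _ _ _ _ fa gb1) (lagrangian_fin _ _ _ _ _ fa gb2).
rewrite (lagrangian_fin _ _ _ _ _ fa gb).
rewrite -!EFinN !lee_fin coupling_conv_dual => h1 h2.
have : \sum_(t < T.+1) b t <=
    l * \sum_(t < T.+1) b1 t + (1 - l) * \sum_(t < T.+1) b2 t.
  rewrite !mulr_sumr -big_split/=; apply: ler_sum => t _.
  by rewrite -lee_fin -gb.
have [l0 l1] := andP l01.
have := ler_wpM2l l0 h1; have := @ler_wpM2l _ (1 - l) _ _ _ h2.
by rewrite subr_ge0 => /(_ l1); lra.
Qed.

Lemma f_dom : exists w (a : 'I_T.+1 -> R), forall t, f t (w t) = (a t)%:E.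
Proof.
have /choice[w /choice[a fa]] t : exists v c, f t v = c%:E by exact: (fP t).2.
by exists [ffun t => w t], a => t; rewrite ffunE.
Qed.

Lemma control_objective_infE q :
  control_objective f g F H z q = ereal_inf [set L p q | p in setT].
Proof.
case: q => u y; rewrite /control_objective.
have [w0 [a0 fa0]] := f_dom.
apply/eqP; rewrite eq_le; apply/andP; split.
  apply/ereal_infP => _ [[w x] _ <-].
  case: asboolP => [yu|_]; last by rewrite leNye.
  have [[t ft]|[a fa]] := f_cases w.
    by rewrite (lagrangian_y _ _ _ _ _ _ _ ft) leey.
  have [[t gt]|[b gb]] := conjg_cases u.
    rewrite (lagrangian_Ny _ _ _ _ _ fa (conjgNy _) gt)// leeNy_eq esum_eqNy.
    by apply/existsP; exists t; rewrite gt adde_eq_ninfty/= eqxx orbT.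
  rewrite (lagrangian_fin _ _ _ _ _ fa gb) coupling_costateE.
  rewrite costate_residual_eq0// addr0.
  have -> : \sum_(t < T.+1) a t - \sum_(t < T.+1) b t +
      (\sum_(t < T.+1) dotv (z t) (u t) - \sum_(t < T.+1) dotv (w t) (y t)) =
    \sum_(t < T.+1) (dotv (z t) (u t) - (dotv (w t) (y t) - a t) - b t).
    by rewrite !sumrB; lra.
  rewrite -sumEFin; apply: lee_sum => t _; rewrite gb.
  have := young_ineq (f t) (w t) (y t); rewrite fa -EFinB.
  case: (convex_conjugate _ _) => [c|_|//].
    by rewrite -!EFinB !lee_fin; lra.
  by rewrite leNye.
apply: lee_above_real => r kr.
have [[t gt]|[b gb]] := conjg_cases u.
  apply: (@le_trans _ _ (L (w0, 0) (u, y))); first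
    by apply: ereal_inf_lbound; exists (w0, 0).
  by rewrite (lagrangian_Ny _ _ _ _ _ fa0 (conjgNy _) gt)// leNye.
move: kr; case: asboolP => [yu kr|/costate_residual_gt0[x xpos] _]; last first.
  (* At [(w0, s *: x)] the Lagrangian equals [k + s * N]; the choice [s = (r - k) / N] makes it
     exactly [r]. *)
  pose N := costate_residual F H u y x.
  pose k := \sum_(t < T.+1) a0 t - \sum_(t < T.+1) b t +
    (\sum_(t < T.+1) dotv (z t) (u t) - \sum_(t < T.+1) dotv (w0 t) (y t)).
  apply: (@le_trans _ _ (L (w0, ((r - k) / N) *: x) (u, y))).
    by apply: ereal_inf_lbound; exists (w0, ((r - k) / N) *: x).
  rewrite (lagrangian_fin _ _ _ _ _ fa0 gb) coupling_costateE.
  by rewrite costate_residualZ addrA -/k divfK ?lt0r_neq0// addrCA subrr addr0.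
(* The negated summands of the control objective. Splitting [- r] among them lets each [w t] be
   chosen as a near-maximizer in the conjugate of [f t] at [y t]. *)
pose S t := (convex_conjugate (f t) (y t) + (b t - dotv (z t) (u t))%:E)%E.
have SNy t : S t != -oo%E by rewrite adde_eq_ninfty negb_or conjfNy.
have : ((- r)%:E < \sum_(t < T.+1) S t)%E.
  rewrite EFinN lteNl -sumeN; last first.
    by move=> s t _ _; rewrite ltninfty_adde_def// inE ltNye.
  congr (_ < _)%E : kr; apply: eq_bigr => t _; rewrite gb /S.
  case: (convex_conjugate _ _) (conjfNy t (y t)) => [c||//] _ //.
  by rewrite -!EFinB -EFinD -EFinN; congr (_%:E); lra.
move=> /(real_below_sum SNy)[m [mS rm]].
have /choice[w /choice[a wa]] t : exists v c, f t v = c%:E /\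
    m t < dotv v (y t) - c + (b t - dotv (z t) (u t)).
  have := mS t; rewrite /S -lteBlDr// -EFinB => /ereal_sup_gt[_ [v _ <-]].
  case fv : (f t v) ((fP t).1 v) => [c||//] _; last by rewrite ltNge leNye.
  by rewrite -EFinB lte_fin ltrBlDr => mv; exists v, c.
pose w' : {ffun _ -> _} := [ffun t => w t].
have fa t : f t (w' t) = (a t)%:E by rewrite ffunE; case: (wa t).
(* Any [x] would do: the costate residual vanishes once the control constraints hold. *)
apply: (@le_trans _ _ (L (w', 0) (u, y))); first
  by apply: ereal_inf_lbound; exists (w', 0).
rewrite (lagrangian_fin _ _ _ _ _ fa gb) coupling_costateE.
rewrite costate_residual_eq0// addr0 lee_fin.
have : \sum_(t < T.+1) m t <=
    \sum_(t < T.+1) (dotv (w' t) (y t) - a t + (b t - dotv (z t) (u t))).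
  by apply: ler_sum => t _; rewrite ffunE; case: (wa t) => _ /ltW.
by rewrite big_split/= !sumrB; lra.
Qed.

Hypotheses (gconv : forall t, econvex setT (g t))
  (glsc : forall t, lower_semicontinuous (g t)).

Let conj_approx t v r :=
  @fenchel_moreau_proper _ _ _ (gP t) v r (@gconv t) (@glsc t).

(** Fenchel-Moreau at a point where [g t] is finite, at a level just below its value, supplies a
    slope with finite conjugate. *)
Lemma conjg_dom : exists u (b : 'I_T.+1 -> R),
  forall t, convex_conjugate (g t) (u t) = (b t)%:E.
Proof.
have /choice[u /choice[b ub]] t : exists v c, convex_conjugate (g t) v = c%:E.
  have [_ [v [c gv]]] := gP t.
  have [|v' [b [gb _]]] := @conj_approx t v (c - 1).
    by rewrite gv lte_fin ltrBlDr ltrDl.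
  by exists v', b.
by exists [ffun t => u t], b => t; rewrite ffunE.
Qed.

Lemma estimation_objective_supE p :
  estimation_objective f g F H z p = ereal_sup [set L p q | q in setT].
Proof.
case: p => w x; rewrite /estimation_objective.
(* The objective uses ordinary addition, where [+oo - oo] is [-oo]; this bound excludes that
   case. *)
have sumgNy : (\sum_(t < T.+1) g t (z t - H t *m x t)%R != -oo)%E.
  rewrite esum_eqNy; apply/existsPn => t /=; exact: (gP t).1.
have [u0 [b0 gb0]] := conjg_dom.
have [[t ft]|[a fa]] := f_cases w.
  transitivity (+oo%E : \bar R).
    case: ifP => // _; have /eqP -> : (\sum_(t < T.+1) f t (w t) == +oo)%E.
      rewrite esum_eqy; last by move=> s _; exact: (fP s).1.
      by apply/existsP; exists t; rewrite ft.
    by rewrite addye.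
  apply/eqP; rewrite eq_sym -leye_eq; apply: ereal_sup_ubound.
  by exists (u0, 0) => //; rewrite (lagrangian_y _ _ _ _ _ _ _ ft).
apply/eqP; rewrite eq_le; apply/andP; split; last first.
  apply/ereal_supP => _ [[u y] _ <-].
  case: asboolP => [xw|_]; last by rewrite leey.
  have [[t gt]|[b gb]] := conjg_cases u.
    by rewrite (lagrangian_Ny _ _ _ _ _ fa (conjgNy _) gt) leNye.
  rewrite (lagrangian_fin _ _ _ _ _ fa gb) /coupling state_residual_eq0// addr0.
  under [X in (_ <= X + _)%E]eq_bigr do rewrite fa.
  rewrite sumEFin -addrA EFinD leeD2l// addrC -sumrB -sumEFin.
  apply: lee_sum => t _.
  have := young_ineq (g t) (z t - H t *m x t) (u t); rewrite gb.
  case: (g t _) => [c|_|//].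
    by rewrite -EFinB !lee_fin; lra.
  by rewrite leey.
apply: lee_below_real => r.
case: asboolP => [xw|/state_residual_gt0[y ypos] _]; last first.
  pose N := state_residual F w x y.
  pose k := \sum_(t < T.+1) a t - \sum_(t < T.+1) b0 t +
    \sum_(t < T.+1) dotv (z t - H t *m x t) (u0 t).
  apply: (@le_trans _ _ (L (w, x) (u0, ((r - k) / N) *: y))); last first.
    by apply: ereal_sup_ubound; exists (u0, ((r - k) / N) *: y).
  rewrite (lagrangian_fin _ _ _ _ _ fa gb0) /coupling.
  by rewrite state_residualZ addrA -/k divfK ?lt0r_neq0// addrCA subrr addr0.
under [X in (_ < X + _)%E]eq_bigr do rewrite fa.
rewrite sumEFin addrC -lteBlDr// -EFinB.
move=> /(real_below_sum (fun t => (gP t).1 _))[m [mg rm]].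
(* Each [u t] is the slope of an affine minorant of [g t] exceeding [m t] at [z t - H t *m x t]. The
   state residual being zero, [y = 0] can accompany it. *)
have /choice[u /choice[b ub]] t := conj_approx (mg t).
pose u' : {ffun _ -> _} := [ffun t => u t].
have gb t : convex_conjugate (g t) (u' t) = (b t)%:E.
  by rewrite ffunE; case: (ub t).
apply: (@le_trans _ _ (L (w, x) (u', 0))); last first.
  by apply: ereal_sup_ubound; exists (u', 0).
rewrite (lagrangian_fin _ _ _ _ _ fa gb) /coupling state_residual_eq0// addr0.
have : \sum_(t < T.+1) m t <=
    \sum_(t < T.+1) (dotv (z t - H t *m x t) (u' t) - b t).
  by apply: ler_sum => t _; rewrite ffunE; case: (ub t) => _ /ltW.
by rewrite lee_fin sumrB; lra.
Qed.

End duality.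

Unset Implicit Arguments.

Theorem theorem2p5 (R : realType) (nx nz T : nat)
    (f : 'I_T.+1 -> 'cV[R]_nx -> \bar R)
    (g : 'I_T.+1 -> 'cV[R]_nz -> \bar R)
    (F : 'I_T -> 'M[R]_nx) (H : 'I_T.+1 -> 'M[R]_(nz, nx))
    (z : 'I_T.+1 -> 'cV[R]_nz)
    (f_density : forall t, log_concave_density (f t))
    (g_density : forall t, log_concave_density (g t))
    (f_lsc : forall t, lower_semicontinuous (f t))
    (g_lsc : forall t, lower_semicontinuous (g t)) :
  dual_problems setT setT
    (estimation_objective f g F H z)
    (control_objective f g F H z)
    (lagrangian f g F H z).
Proof.
have fP t := log_concave_density_proper (f_density t).
have gP t := log_concave_density_proper (g_density t).
have fconv t : econvex setT (f t) by case: (f_density t).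
have gconv t : econvex setT (g t) by case: (g_density t).
split; first split.
- by move=> q _; exact: lagrangian_econvex.
- by move=> p _; exact: lagrangian_econcave.
- by move=> p _; exact: estimation_objective_supE.
- by move=> q _; exact: control_objective_infE.
Qed.
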